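(* Fix an integer $i\geq 6$ and the data used to construct the groups $T_{\mathcal{P}}$ (as described in the context). Let $\mathbb{T}_{\operatorname{Fin}}$ be the class of groups $T_{\mathcal{Q}}$ where $\mathcal{Q}$ is a countable group presentation such that $\pi_1(\mathcal{Q})$ is finite. Let $\mathcal{P}$ be a countable group presentation. If $\pi_1(\mathcal{P})$ is residually finite then $T_{\mathcal{P}}$ is residually-$\mathbb{T}_{\operatorname{Fin}}$.
   Context: A countable group presentation is $\mathcal{P}=\langle\mathbf{x};\mathbf{r}\rangle$ with $|\mathbf{x}|\leq|\mathbb{N}|$ (finite or countably infinite generating set); $\pi_1(\mathcal{P})=F(\mathbf{x})/\langle\langle\mathbf{r}\rangle\rangle$, where $\langle\langle\mathbf{r}\rangle\rangle$ is the normal closure of $\mathbf{r}$ in $F(\mathbf{x})$. For a group $H$, a proper subgroup $K\lneq H$ and $\phi\in\operatorname{Aut}(H)$, put $H\ast_{(K,\phi)}=\langle H,t;\ tkt^{-1}=\phi(k),\ k\in K\rangle$. A subgroup $M\leq H$ is malcharacteristic in $H$ if for all $\delta\in\operatorname{Aut}(H)$: $\delta(M)\cap M\neq 1$ implies $\delta\in\operatorname{Inn}(M):=\{\gamma_h: h\in M\}$, where $\gamma_h(g)=h^{-1}gh$ for $g\in H$. Construction of $T_{\mathcal{P}}$. Let $T_i=\langle a,b;\ a^i,b^i,(ab)^i\rangle$ and let $\phi\in\operatorname{Aut}(T_i)$ be the automorphism $a\mapsto b$, $b\mapsto b^{-1}a^{-1}$. For each $n\in\mathbb{N}\cup\{\infty\}$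 (where $\infty=|\mathbb{N}|$) fix a malcharacteristic subgroup $M_n$ of $T_i$ which is free of rank $n$ (such subgroups exist). Given $\mathcal{P}=\langle\mathbf{x};\mathbf{r}\rangle$, put $\widehat{\mathbf{x}}=\mathbf{x}\sqcup\{p,q\}$ and $\widehat{\mathbf{r}}=\mathbf{r}\sqcup\{p,q\}$, where $p,q$ are new letters, and identify $F(\widehat{\mathbf{x}})$ with $M_{|\widehat{\mathbf{x}}|}$ via an isomorphism fixed once and for all for each $\mathbf{x}$. Let $K_{\mathcal{P}}\leq M_{|\widehat{\mathbf{x}}|}$ be the subgroup corresponding to the normal closure of $\widehat{\mathbf{r}}$ in $F(\widehat{\mathbf{x}})$. Then $T_{\mathcal{P}}:=T_i\ast_{(K_{\mathcal{P}},\phi)}$. For a class of groups $\mathcal{C}$, a group $G$ is residually-$\mathcal{C}$ if for every $g\in G\setminus\{1\}$ there is a surjective homomorphism $\sigma: G\to C$ with $C\in\mathcal{C}$ and $\sigma(g)\neq 1$. *)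

(* Defs.v *)
From HB Require Import structures.
From mathcomp Require Import all_boot.
From mathcomp Require Import boolp classical_sets functions cardinality.

Set Implicit Arguments.
Unset Strict Implicit.
Unset Printing Implicit Defensive.

Local Open Scope classical_set_scope.
Local Open Scope group_scope.
Local Open Scope quotient_scope.
Local Open Scope card_scope.

Notation hom := UMagmaMorphism.type.

Lemma morph_hom (G H : groupType) (f : G -> H) :
  {morph f : x y / x * y} -> monoid_morphism f.
Proof.
move=> fM; split=> //; apply: (@mulgI _ (f 1)).
by rewrite -fM !mulg1.
Qed.

Section FreeGroup.
Variable X : choiceType.

(* The letter (x, true) stands for x, and (x, false) for its inverse. *)
Definition word : choiceType := seq (X * bool).

Definition flip (l : X * bool) : X * bool := (l.1, ~~ l.2).

Inductive free_eq : word -> word -> Prop :=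
| free_eq_refl w : free_eq w w
| free_eq_sym u v : free_eq u v -> free_eq v u
| free_eq_trans v u w : free_eq u v -> free_eq v w -> free_eq u w
| free_eq_cancel u v l : free_eq (u ++ l :: flip l :: v) (u ++ v).

Definition free_eqb (u v : word) : bool := `[< free_eq u v >].

Lemma free_eqb_equiv : equiv_class_of free_eqb.
Proof.
split.
- by move=> w; apply/asboolP; apply: free_eq_refl.
- by move=> u v; apply/asboolP/asboolP; apply: free_eq_sym.
- move=> v u w /asboolP uv /asboolP vw; apply/asboolP.
  exact: free_eq_trans uv vw.
Qed.

Canonical free_equiv := EquivRelPack free_eqb_equiv.

Definition free_group := {eq_quot free_equiv}.

HB.instance Definition _ := Choice.on free_group.

Definition free_class (w : word) : free_group := \pi w.

Lemma free_classP u v : free_class u = free_class v <-> free_eq u v.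
Proof.
split=> [/eqmodP /asboolP //|uv]; by apply/eqmodP/asboolP.
Qed.

Lemma free_class_repr (g : free_group) : free_class (repr g) = g.
Proof. exact: reprK. Qed.

Lemma repr_free_class w : free_eq (repr (free_class w)) w.
Proof. by apply/free_classP; rewrite free_class_repr. Qed.

Definition winv (w : word) : word := rev (map flip w).

Lemma flipK : involutive flip.
Proof. by case=> x b; rewrite /flip /= negbK. Qed.

Lemma winvK : involutive winv.
Proof.
move=> w; rewrite /winv map_rev revK -map_comp -[RHS]map_id.
by apply: eq_map => l /=; rewrite flipK.
Qed.

Lemma free_eq_catl u v w : free_eq u v -> free_eq (w ++ u) (w ++ v).
Proof.
elim=> [?|? ? _ IH|? ? ? _ IH1 _ IH2|a b l].
- exact: free_eq_refl.
- exact: free_eq_sym.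
- exact: free_eq_trans IH1 IH2.
- by rewrite !catA; apply: free_eq_cancel.
Qed.

Lemma free_eq_catr u v w : free_eq u v -> free_eq (u ++ w) (v ++ w).
Proof.
elim=> [?|? ? _ IH|? ? ? _ IH1 _ IH2|a b l].
- exact: free_eq_refl.
- exact: free_eq_sym.
- exact: free_eq_trans IH1 IH2.
- by rewrite -!catA; apply: free_eq_cancel.
Qed.

Lemma free_eq_cat u u' v v' :
  free_eq u u' -> free_eq v v' -> free_eq (u ++ v) (u' ++ v').
Proof.
move=> uu' vv'; apply: free_eq_trans (free_eq_catl _ vv').
exact: free_eq_catr.
Qed.

Lemma free_eq_winv u v : free_eq u v -> free_eq (winv u) (winv v).
Proof.
elim=> [?|? ? _ IH|? ? ? _ IH1 _ IH2|a b l].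
- exact: free_eq_refl.
- exact: free_eq_sym.
- exact: free_eq_trans IH1 IH2.
- rewrite /winv !map_cat !rev_cat /= !rev_cons -!cats1 -!catA /=.
  by rewrite -{2}(flipK l) flipK; apply: free_eq_cancel.
Qed.

Lemma free_eq_mulV w : free_eq (w ++ winv w) [::].
Proof.
elim: w => [|l w IH]; first exact: free_eq_refl.
rewrite /winv /= rev_cons -cats1 -/(winv w) catA.
apply: free_eq_trans (free_eq_cancel [::] [::] l).
by apply: (@free_eq_catl _ _ [:: l]); apply: (@free_eq_catr _ [::] [:: _]).
Qed.

Definition free_mul (g h : free_group) := free_class (repr g ++ repr h).
Definition free_inv (g : free_group) := free_class (winv (repr g)).
Definition free_one := free_class [::].

Lemma free_mulE u v :
  free_mul (free_class u) (free_class v) = free_class (u ++ v).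
Proof. by apply/free_classP/free_eq_cat; apply: repr_free_class. Qed.

Lemma free_invE u : free_inv (free_class u) = free_class (winv u).
Proof. by apply/free_classP/free_eq_winv; apply: repr_free_class. Qed.

Lemma free_mulA : associative free_mul.
Proof.
move=> f g h; rewrite -(free_class_repr f) -(free_class_repr g).
by rewrite -(free_class_repr h) !free_mulE catA.
Qed.

Lemma free_mul1 : left_id free_one free_mul.
Proof. by move=> g; rewrite -(free_class_repr g) free_mulE. Qed.

Lemma free_1mul : right_id free_one free_mul.
Proof. by move=> g; rewrite -(free_class_repr g) free_mulE cats0. Qed.

Lemma free_mulgV : right_inverse free_one free_inv free_mul.
Proof.
move=> g; rewrite -(free_class_repr g) free_invE free_mulE.
exact/free_classP/free_eq_mulV.
Qed.

Lemma free_mulVg : left_inverse free_one free_inv free_mul.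
Proof.
move=> g; rewrite -(free_class_repr g) free_invE free_mulE.
by apply/free_classP; rewrite -{2}(winvK (repr g)); apply: free_eq_mulV.
Qed.

HB.instance Definition _ := isGroup.Build free_group
  free_mulA free_mul1 free_1mul free_mulVg free_mulgV.

Definition free_gen (x : X) : free_group := free_class [:: (x, true)].

Section Lift.
Variables (G : groupType) (f : X -> G).

Definition letter_val (l : X * bool) : G := if l.2 then f l.1 else (f l.1)^-1.

Definition word_val (w : word) : G := \prod_(l <- w) letter_val l.

(* The homomorphism F(X) -> G extending f. *)
Definition free_lift (g : free_group) : G := word_val (repr g).

Lemma word_val_eq u v : free_eq u v -> word_val u = word_val v.
Proof.
elim=> [//|//|? ? ? _ -> _ -> //|a b [x c]].
rewrite /word_val !big_cat /= !big_cons; congr (_ * _).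
by rewrite [LHS]mulgA; case: c; rewrite /letter_val /= ?mulgV ?mulVg mul1g.
Qed.

Lemma free_lift_class w : free_lift (free_class w) = word_val w.
Proof. exact/word_val_eq/repr_free_class. Qed.

Lemma free_lift_gen x : free_lift (free_gen x) = f x.
Proof. by rewrite free_lift_class /word_val big_seq1. Qed.

Lemma free_liftM : {morph free_lift : g h / g * h}.
Proof.
move=> g h; rewrite -(free_class_repr g) -(free_class_repr h).
rewrite [_ * _]free_mulE !free_lift_class /word_val big_cat.
by [].
Qed.

HB.instance Definition _ :=
  isUMagmaMorphism.Build free_group G free_lift (morph_hom free_liftM).

End Lift.

End FreeGroup.

Arguments free_gen {X} x.

Definition free_map (X Y : choiceType) (f : X -> Y) :
    hom (free_group X) (free_group Y) :=
  free_lift (fun x => free_gen (f x)).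

Definition subgroup (G : groupType) (S : set G) : Prop :=
  [/\ S 1, forall x y, S x -> S y -> S (x * y) & forall x, S x -> S x^-1].

Definition normal_subgroup (G : groupType) (N : set G) : Prop :=
  subgroup N /\ forall x g, N x -> N (x ^ g).

Definition normal_closure (G : groupType) (R : set G) : set G :=
  smallest (@normal_subgroup G) R.

Lemma normal_closureP (G : groupType) (R : set G) :
  normal_subgroup (normal_closure R).
Proof.
split; first split.
- by move=> N [[[]]].
- by move=> x y Nx Ny N NR; have [[[_ M _] _] _] := NR; apply: M;
    [apply: Nx|apply: Ny].
- by move=> x Nx N NR; have [[[_ _ V] _] _] := NR; apply: V; apply: Nx.
- by move=> x g Nx N NR; have [[_ J] _] := NR; apply: J; apply: Nx.
Qed.

Section Quotient.
Variables (G : groupType) (R : set G).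

Definition quo_eqb (x y : G) : bool := `[< normal_closure R (x^-1 * y) >].

Lemma quo_eqb_equiv : equiv_class_of quo_eqb.
Proof.
have [[N1 NM NV] _] := normal_closureP R.
split.
- by move=> x; apply/asboolP; rewrite mulVg.
- suff S x y : quo_eqb x y -> quo_eqb y x by move=> x y; apply/idP/idP; apply: S.
  by move=> /asboolP /NV; rewrite invgM invgK => ?; apply/asboolP.
- move=> y x z /asboolP xy /asboolP yz; apply/asboolP.
  by have := NM _ _ xy yz; rewrite mulgA -(mulgA x^-1) mulgV mulg1.
Qed.

Canonical quo_equiv := EquivRelPack quo_eqb_equiv.

(* G / <<R>>, for an arbitrary (not necessarily normal) subset R. *)
Definition quo := {eq_quot quo_equiv}.

HB.instance Definition _ := Choice.on quo.

Definition quo_class (x : G) : quo := \pi x.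

Lemma quo_classP x y : quo_class x = quo_class y <-> normal_closure R (x^-1 * y).
Proof.
split=> [/eqmodP /asboolP //|xy]; by apply/eqmodP/asboolP.
Qed.

Lemma quo_class_repr (x : quo) : quo_class (repr x) = x.
Proof. exact: reprK. Qed.

Lemma repr_quo_class x : normal_closure R ((repr (quo_class x))^-1 * x).
Proof. by apply/quo_classP; rewrite quo_class_repr. Qed.

Definition quo_mul (x y : quo) := quo_class (repr x * repr y).
Definition quo_inv (x : quo) := quo_class (repr x)^-1.
Definition quo_one := quo_class 1.

Lemma quo_mulE x y : quo_mul (quo_class x) (quo_class y) = quo_class (x * y).
Proof.
have [[N1 NM NV] NJ] := normal_closureP R.
apply/quo_classP.
have := NM _ _ (NJ _ (repr (quo_class y)) (repr_quo_class x)) (repr_quo_class y).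
by rewrite /conjg invgM !mulgA mulgK.
Qed.

Lemma quo_invE x : quo_inv (quo_class x) = quo_class x^-1.
Proof.
have [[N1 NM NV] NJ] := normal_closureP R.
apply/quo_classP.
have := NJ _ x^-1 (NV _ (repr_quo_class x)).
by rewrite /conjg invgM !invgK !mulgA mulgV mul1g.
Qed.

Lemma quo_mulA : associative quo_mul.
Proof.
move=> x y z; rewrite -(quo_class_repr x) -(quo_class_repr y).
by rewrite -(quo_class_repr z) !quo_mulE mulgA.
Qed.

Lemma quo_mul1 : left_id quo_one quo_mul.
Proof. by move=> x; rewrite -(quo_class_repr x) quo_mulE mul1g. Qed.

Lemma quo_1mul : right_id quo_one quo_mul.
Proof. by move=> x; rewrite -(quo_class_repr x) quo_mulE mulg1. Qed.

Lemma quo_mulVg : left_inverse quo_one quo_inv quo_mul.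
Proof. by move=> x; rewrite -(quo_class_repr x) quo_invE quo_mulE mulVg. Qed.

Lemma quo_mulgV : right_inverse quo_one quo_inv quo_mul.
Proof. by move=> x; rewrite -(quo_class_repr x) quo_invE quo_mulE mulgV. Qed.

HB.instance Definition _ := isGroup.Build quo
  quo_mulA quo_mul1 quo_1mul quo_mulVg quo_mulgV.

Lemma quo_classM : {morph quo_class : x y / x * y}.
Proof. by move=> x y; rewrite [RHS]quo_mulE. Qed.

HB.instance Definition _ := isUMagmaMorphism.Build G quo quo_class (morph_hom quo_classM).

End Quotient.

Arguments quo_class {G} R x.
Arguments repr_quo_class {G} R x.

Section QuotientLift.
Variables (G H : groupType) (R : set G) (f : hom G H).
Hypothesis fR : forall r, R r -> f r = 1.

Lemma normal_closure_ker x : normal_closure R x -> f x = 1.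
Proof.
move=> /(_ [set x | f x = 1]); apply; split=> //; split; first split=> /=.
- exact: gmulf1.
- by move=> u v fu fv; rewrite gmulfM fu fv mulg1.
- by move=> u fu; rewrite gmulfV fu invg1.
- by move=> u g /= fu; rewrite gmulfJ fu conj1g.
Qed.

Lemma quo_liftE x : f (repr (quo_class R x)) = f x.
Proof.
have := normal_closure_ker (repr_quo_class R x).
rewrite gmulfM gmulfV => /(congr1 (mul (f (repr (quo_class R x))))).
by rewrite mulgA mulgV mul1g mulg1.
Qed.

Lemma quo_liftM : {morph (fun x : quo R => f (repr x)) : x y / x * y}.
Proof.
move=> x y; rewrite -(quo_class_repr x) -(quo_class_repr y).
by rewrite -quo_classM !quo_liftE gmulfM.
Qed.

End QuotientLift.

Definition presented (X : choiceType) (R : set (free_group X)) : groupType :=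
  quo R.

Definition pgen (X : choiceType) (R : set (free_group X)) (x : X) :
  presented R := quo_class R (free_gen x).

Lemma presented_hom_ext (X : choiceType) (R : set (free_group X))
    (G : groupType) (f g : hom (presented R) G) :
  (forall x, f (pgen R x) = g (pgen R x)) -> f =1 g.
Proof.
move=> fg u; rewrite -(quo_class_repr u) -(free_class_repr (repr u)).
elim: (repr (repr u)) => [|[x b] w IH].
  rewrite -[free_class [::]]/(1 : free_group X) -[quo_class R 1]/(1 : quo R).
  by rewrite !gmulf1.
have -> : free_class ((x, b) :: w) = free_class [:: (x, b)] * free_class w.
  by rewrite [RHS]free_mulE.
rewrite gmulfM !gmulfM IH; congr (_ * _).
case: b; first exact: fg.
have -> : free_class [:: (x, false)] = (free_gen x)^-1.
  by rewrite [RHS]free_invE.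
by rewrite gmulfV !gmulfV; congr (_^-1); apply: fg.
Qed.

Record countable_presentation := CountablePresentation {
  pres_gen : countType;
  pres_rel : set (free_group pres_gen)
}.

Definition pi1 (P : countable_presentation) : groupType :=
  presented (@pres_rel P).

(* H *_(K, phi) = < H, t; t k t^-1 = phi k, k \in K >.  The generators are    *)
(* the elements of H (as Some h) and the stable letter t (as None); the       *)
(* multiplication table of H is the first family of relators. The usual       *)
(* hypotheses (K a proper subgroup of H, phi bijective) are not needed to     *)
(* write down the presentation; they hold wherever HNN is used below.         *)
Definition HNN_rel (H : groupType) (K : set H) (phi : hom H H) :
    set (free_group (option H)) :=
  let h_ (h : H) := free_gen (Some h) in let t := free_gen None in
  [set r | exists h k, r = h_ h * h_ k * (h_ (h * k))^-1] `|`
  [set r | exists2 k, K k & r = t * h_ k * t^-1 * (h_ (phi k))^-1].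

Definition HNN (H : groupType) (K : set H) (phi : hom H H) :
  groupType := presented (HNN_rel K phi).

(* In MathComp, g ^ h is h^-1 * g * h. *)
Definition malcharacteristic (H : groupType) (M : set H) : Prop :=
  forall d : hom H H, bijective d ->
    (d @` M) `&` M <> [set 1] ->
    exists2 h, M h & forall g, d g = g ^ h.

(* The rank n \in N u {oo} is encoded as Some n for n finite and None for oo. *)
Definition has_card (X : Type) (n : option nat) : Prop :=
  [set: X] #= (if n is Some m then `I_m else [set: nat]).

Definition free_of_rank (H : groupType) (M : set H) (n : option nat) : Prop :=
  exists (X : countType) (f : hom (free_group X) H),
    [/\ has_card X n, injective f & range f = M].

Section Triangle.
Variable i : nat.

(* The generators a and b are indexed by true and false. *)
Definition tri_rel : set (free_group bool) :=
  let a := free_gen true in let b := free_gen false in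
  [set a ^+ i; b ^+ i; (a * b) ^+ i].

Definition tri : groupType := presented tri_rel.

Definition tri_a : tri := pgen tri_rel true.
Definition tri_b : tri := pgen tri_rel false.

Lemma tri_rels : [/\ tri_a ^+ i = 1, tri_b ^+ i = 1 & (tri_a * tri_b) ^+ i = 1].
Proof.
have K r : tri_rel r -> quo_class tri_rel r = 1.
  by move=> rR; apply/quo_classP; rewrite mulg1 => N NR;
    have [[[_ _ V] _] RN] := NR; apply/V/RN.
split; rewrite /tri_a /tri_b /pgen -?gmulfM -gmulfXn; apply: K.
- by left; left.
- by left; right.
- by right.
Qed.

Definition tri_phi_gen (x : bool) : tri :=
  if x then tri_b else tri_b^-1 * tri_a^-1.

Lemma tri_phi_rel r : tri_rel r -> free_lift tri_phi_gen r = 1.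
Proof.
have [Ha Hb Hab] := tri_rels.
case=> [[->|->]|->]; rewrite gmulfXn ?gmulfM /= !free_lift_gen /=.
- exact: Hb.
- by rewrite -invgM expVgn Hab invg1.
- by rewrite mulgA mulgV mul1g expVgn Ha invg1.
Qed.

(* The automorphism a |-> b, b |-> b^-1 a^-1. *)
Definition tri_phi (x : tri) : tri := free_lift tri_phi_gen (repr x).

HB.instance Definition _ := isUMagmaMorphism.Build tri tri tri_phi
  (morph_hom (quo_liftM tri_phi_rel)).

Lemma tri_phi_a : tri_phi tri_a = tri_b.
Proof.
by rewrite /tri_phi /tri_a /pgen (quo_liftE tri_phi_rel) /= free_lift_gen.
Qed.

Lemma tri_phi_b : tri_phi tri_b = tri_b^-1 * tri_a^-1.
Proof.
by rewrite /tri_phi /tri_b /pgen (quo_liftE tri_phi_rel) /= free_lift_gen.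
Qed.

Lemma tri_phi_ba : tri_phi (tri_b^-1 * tri_a^-1) = tri_a.
Proof.
pose f : hom tri tri := tri_phi.
have fa : f tri_a = tri_b := tri_phi_a.
have fb : f tri_b = tri_b^-1 * tri_a^-1 := tri_phi_b.
rewrite -[LHS]/(f _) gmulfM !gmulfV fa fb.
by rewrite invgM !invgK mulgK.
Qed.

Lemma tri_phi3 x : tri_phi (tri_phi (tri_phi x)) = x.
Proof.
pose f : hom tri tri := tri_phi \o (tri_phi \o tri_phi).
apply: (@presented_hom_ext _ tri_rel _ f idfun) => -[] /=.
- rewrite -/tri_a -[LHS]/(tri_phi (tri_phi (tri_phi tri_a))) tri_phi_a.
  by rewrite tri_phi_b tri_phi_ba.
- rewrite -/tri_b -[LHS]/(tri_phi (tri_phi (tri_phi tri_b))) tri_phi_b.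
  by rewrite tri_phi_ba tri_phi_a.
Qed.

Lemma tri_phi_bij : bijective tri_phi.
Proof. by exists (tri_phi \o tri_phi) => x /=; rewrite tri_phi3. Qed.

End Triangle.

(* The alphabet x u {p, q}: inr true is p and inr false is q. *)
Definition hat (X : countType) : countType := (X + bool)%type.

Definition hat_rel (X : countType) (R : set (free_group X)) :
    set (free_group (hat X)) :=
  free_map (inl : X -> hat X) @` R `|`
  [set free_gen (inr true : hat X); free_gen (inr false : hat X)].

(* The choices made once and for all: malc n is M_n, and ident X identifies   *)
(* F(x u {p, q}) with M_n, where n is the cardinality of x u {p, q}.          *)
Record Tdata (i : nat) := {
  malc : option nat -> set (tri i);
  malc_subgroup : forall n, subgroup (malc n);
  malc_char : forall n, malcharacteristic (malc n);
  malc_free : forall n, free_of_rank (malc n) n;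
  ident : forall X : countType, hom (free_group (hat X)) (tri i);
  ident_inj : forall X, injective (@ident X);
  ident_range : forall (X : countType) n,
    has_card (hat X) n -> range (@ident X) = malc n
}.

Section Construction.
Variables (i : nat) (D : Tdata i).

Definition KP (P : countable_presentation) : set (tri i) :=
  @ident i D (pres_gen P) @` normal_closure (hat_rel (@pres_rel P)).

Definition TP (P : countable_presentation) : groupType :=
  HNN (KP P) (@tri_phi i).

Definition T_Fin (H : groupType) : Prop :=
  exists2 Q : countable_presentation, finite_set [set: pi1 Q] & H = TP Q.

End Construction.

Definition residually (C : groupType -> Prop) (G : groupType) : Prop :=
  forall g : G, g <> 1 ->
    exists (H : groupType) (s : hom G H),
      [/\ C H, forall h, exists x, s x = h & s g <> 1].

Definition residually_finite (G : groupType) : Prop :=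
  residually (fun H => finite_set [set: H]) G.

(* Main.v *)
Require Import Defs.
From HB Require Import structures.
From mathcomp Require Import all_boot.
From mathcomp Require Import boolp classical_sets cardinality.

Set Implicit Arguments.
Unset Strict Implicit.
Unset Printing Implicit Defensive.

(** Enlarging the relators of a presentation P to a set N on the same alphabet
    enlarges the associated subgroup K_P to K_N, so T_P maps onto T_N by the
    identity on generators. The theorem amounts to choosing, for a given u <> 1
    in T_P, a set N with pi_1 finite such that u survives in T_N.

    Write u as a word h t^e1 g1 t^e2 g2 ... without pinches, i.e. without a
    subword t k t^-1 with k in K_P or t^-1 k t with k in phi(K_P)
    ([hnn_reduced_form]). By Britton's lemma ([britton]) such a word is trivial
    only if it is the empty word with h = 1. Hence u survives in T_N as soon as
    the word has no pinch with respect to K_N either, and this only requires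
    finitely many elements of T_i outside K_P to stay outside K_N
    ([hnn_separation]). An element outside M never lies in K_N. An element of
    M outside K_P is, M being identified with the free group on x, p and q, a
    word whose image after deleting p and q is nontrivial in pi_1(P)
    ([KP_ident]); residual finiteness of pi_1(P) gives an N of finite quotient
    which avoids it. Intersecting the finitely many such N separates all the
    elements at once ([KP_separation_seq]).

    Britton's lemma comes from an action of the HNN extension on normal forms,
    in the style of van der Waerden. What makes it short here is that phi is an
    automorphism of the whole base group, with an inverse psi: the two
    associated subgroups K and phi(K) and the two isomorphisms between them are
    then exchanged by a mere change of sign, so each step is checked once for
    both signs of the stable letter. *)

(** * Homomorphisms out of presented groups *)

Section Presented.
Local Open Scope group_scope.
Local Open Scope classical_set_scope.

Lemma mem_normal_closure (G : groupType) (R : set G) x :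
  R x -> normal_closure R x.
Proof. by move=> Rx N [_]; apply. Qed.

Lemma normal_closure_min (G : groupType) (R N : set G) :
  normal_subgroup N -> R `<=` N -> normal_closure R `<=` N.
Proof. by move=> nN RN x; apply. Qed.

Lemma quo_class_eq1 (G : groupType) (R : set G) x :
  quo_class R x = 1 <-> normal_closure R x.
Proof.
have [[_ _ NV] _] := normal_closureP R.
split=> [/esym/quo_classP|Nx]; first by rewrite invg1 mul1g.
by apply/esym/quo_classP; rewrite invg1 mul1g.
Qed.

Lemma free_group_ind (X : choiceType) (S : free_group X -> Prop) :
  S 1 -> (forall x u, S u -> S (free_gen x * u)) ->
  (forall x u, S u -> S ((free_gen x)^-1 * u)) -> forall u, S u.
Proof.
move=> S1 Sg SV u; rewrite -(free_class_repr u).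
elim: (repr u) => [//|[x b] w IH].
have -> : free_class ((x, b) :: w) = free_class [:: (x, b)] * free_class w.
  by rewrite [RHS]free_mulE.
case: b; first exact: Sg.
have -> : free_class [:: (x, false)] = (free_gen x)^-1 by rewrite [RHS]free_invE.
exact: SV.
Qed.

Lemma free_hom_ext (X : choiceType) (G : groupType) (f g : hom (free_group X) G) :
  (forall x, f (free_gen x) = g (free_gen x)) -> f =1 g.
Proof.
move=> fg; apply: free_group_ind => [|x u IH|x u IH].
- by rewrite !gmulf1.
- by rewrite !gmulfM IH fg.
- by rewrite !gmulfM !gmulfV IH fg.
Qed.

Lemma presented_ind (X : choiceType) (R : set (free_group X))
    (S : presented R -> Prop) :
  S 1 -> (forall x u, S u -> S (pgen R x * u)) ->
  (forall x u, S u -> S ((pgen R x)^-1 * u)) -> forall u, S u.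
Proof.
move=> S1 Sg SV u; rewrite -(quo_class_repr u).
elim/free_group_ind: (repr u) => [|x v IH|x v IH].
- by rewrite gmulf1.
- by rewrite gmulfM; apply: Sg.
- by rewrite gmulfM gmulfV; apply: SV.
Qed.

Lemma presented_lift (X : choiceType) (R : set (free_group X)) (G : groupType)
    (f : X -> G) : (forall r, R r -> free_lift f r = 1) ->
  exists F : hom (presented R) G, forall x, F (pgen R x) = f x.
Proof.
move=> fR; pose F0 (x : quo R) := free_lift f (repr x).
pose m := isUMagmaMorphism.Build (quo R) G F0 (morph_hom (quo_liftM fR)).
pose F : hom (quo R) G := HB.pack F0 m.
by exists F => x; rewrite [LHS](quo_liftE fR) /= free_lift_gen.
Qed.

End Presented.

(** * The group of all permutations of a type *)

Section Sym.
Local Open Scope group_scope.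
Variable T : Type.

Record sym := Sym {
  sym_fun :> T -> T;
  sym_inv : T -> T;
  sym_funK : cancel sym_fun sym_inv;
  sym_invK : cancel sym_inv sym_fun }.

HB.instance Definition _ := gen_eqMixin sym.
HB.instance Definition _ := gen_choiceMixin sym.

Lemma sym_ext (f g : sym) : f =1 g -> f = g.
Proof.
case: f g => [f f' fK f'K] [g g' gK g'K] /= /funext fg; subst g.
have e : f' = g' by apply/funext => x; rewrite -[in LHS](g'K x) fK.
by subst g'; rewrite (Prop_irrelevance fK gK) (Prop_irrelevance f'K g'K).
Qed.

Definition sym_mul (f g : sym) :=
  Sym (can_comp (sym_funK f) (sym_funK g)) (can_comp (sym_invK g) (sym_invK f)).
Definition sym_one : sym := @Sym id id (frefl _) (frefl _).
Definition sym_op (f : sym) := Sym (sym_invK f) (sym_funK f).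

Lemma sym_mulA : associative sym_mul.
Proof. by move=> f g h; apply: sym_ext. Qed.
Lemma sym_mul1 : left_id sym_one sym_mul.
Proof. by move=> f; apply: sym_ext. Qed.
Lemma sym_1mul : right_id sym_one sym_mul.
Proof. by move=> f; apply: sym_ext. Qed.
Lemma sym_mulVg : left_inverse sym_one sym_op sym_mul.
Proof. by move=> f; apply: sym_ext => x /=; rewrite sym_funK. Qed.
Lemma sym_mulgV : right_inverse sym_one sym_op sym_mul.
Proof. by move=> f; apply: sym_ext => x /=; rewrite sym_invK. Qed.

HB.instance Definition _ := isGroup.Build sym
  sym_mulA sym_mul1 sym_1mul sym_mulVg sym_mulgV.

End Sym.

(** * Representatives of left cosets *)

Section CosetRep.
Local Open Scope group_scope.
Local Open Scope classical_set_scope.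
Variables (H : groupType) (S : set H).
Hypothesis sS : subgroup S.

(** A representative of h S depending only on the coset; S itself is
    represented by 1, so that representatives detect membership in S. *)
Definition coset_rep (h : H) : H :=
  if `[< S h >] then 1 else xget 1 [set r | S (r^-1 * h)].

Lemma coset_rep_mem h : S ((coset_rep h)^-1 * h).
Proof.
rewrite /coset_rep; case: asboolP => [Sh|_]; first by rewrite invg1 mul1g.
by case: xgetP => [r _ //|/(_ h)]; rewrite /= mulVg; case: sS.
Qed.

Lemma subgroupMr k h : S k -> S (h * k) <-> S h.
Proof.
move=> Sk; have [_ SM SV] := sS.
by split=> [/SM/(_ (SV _ Sk))|/SM/(_ Sk)//]; rewrite mulgK.
Qed.

Lemma subgroupMl k h : S k -> S (k * h) <-> S h.
Proof.
move=> Sk; have [_ SM SV] := sS.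
by split=> [/(SM _ _ (SV _ Sk))|/(SM _ _ Sk)//]; rewrite mulKg.
Qed.

Lemma coset_repMr h k : S k -> coset_rep (h * k) = coset_rep h.
Proof.
move=> Sk; rewrite /coset_rep (asbool_equiv_eq (subgroupMr h Sk)).
congr (if _ then _ else xget _ _); apply/funext => r /=.
by apply/propext; rewrite mulgA; apply: subgroupMr.
Qed.

Lemma coset_rep_eq1 h : coset_rep h = 1 <-> S h.
Proof.
split=> [e|]; last by rewrite /coset_rep; case: asboolP.
by have := coset_rep_mem h; rewrite e invg1 mul1g.
Qed.

Lemma coset_rep_id h : coset_rep (coset_rep h) = coset_rep h.
Proof.
by rewrite -[in LHS](coset_repMr _ (coset_rep_mem h)) mulVKg.
Qed.

End CosetRep.

(** * HNN extensions and Britton's lemma *)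

Section HNNTheory.
Local Open Scope group_scope.
Local Open Scope classical_set_scope.
Variables (H : groupType) (K : set H) (phi : hom H H).
Local Notation G := (HNN K phi).

Definition hnn_base (h : H) : G := pgen (HNN_rel K phi) (Some h).
Definition hnn_stable (e : bool) : G :=
  if e then pgen (HNN_rel K phi) None else (pgen (HNN_rel K phi) None)^-1.

Lemma hnn_baseM : {morph hnn_base : h k / h * k}.
Proof.
move=> h k; apply/esym/divg1_eq.
have : HNN_rel K phi (free_gen (Some h) * free_gen (Some k) *
    (free_gen (Some (h * k)))^-1) by left; exists h, k.
by move=> /mem_normal_closure/quo_class_eq1; rewrite !gmulfM gmulfV.
Qed.

Lemma hnn_base1 : hnn_base 1 = 1.
Proof. exact: (morph_hom hnn_baseM).1. Qed.

Lemma hnn_baseV h : hnn_base h^-1 = (hnn_base h)^-1.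
Proof. by apply/esym/mulg1_eq; rewrite -hnn_baseM mulgV hnn_base1. Qed.

Lemma hnn_stableJ k :
  K k -> hnn_stable true * hnn_base k = hnn_base (phi k) * hnn_stable true.
Proof.
move=> Kk; apply: (canRL (mulgVK _)); apply/divg1_eq.
have : HNN_rel K phi (free_gen None * free_gen (Some k) * (free_gen None)^-1 *
    (free_gen (Some (phi k)))^-1) by right; exists k.
by move=> /mem_normal_closure/quo_class_eq1; rewrite !gmulfM !gmulfV.
Qed.

Lemma hnn_lift (L : groupType) (f : H -> L) (t : L) :
  {morph f : h k / h * k} -> (forall k, K k -> t * f k = f (phi k) * t) ->
  exists F : hom G L,
    (forall h, F (hnn_base h) = f h) /\ F (hnn_stable true) = t.
Proof.
move=> fM ft; pose g x := if x is Some h then f h else t.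
have [|F FE] := @presented_lift _ (HNN_rel K phi) _ g.
  move=> r [[h [k ->]]|[k Kk ->]]; rewrite !gmulfM !gmulfV /= !free_lift_gen /=.
    by rewrite fM mulgV.
  by rewrite ft // mulgK mulgV.
by exists F; split=> [h|]; apply: FE.
Qed.

End HNNTheory.

Section Britton.
Local Open Scope group_scope.
Local Open Scope classical_set_scope.
Variables (H : groupType) (K : set H) (phi psi : hom H H).
Hypotheses (sK : subgroup K) (phiK : cancel phi psi) (psiK : cancel psi phi).
Local Notation G := (HNN K phi).
Local Notation base := (hnn_base K phi).
Local Notation stable := (hnn_stable K phi).

Definition twist (e : bool) : hom H H := if e then phi else psi.

(** Whether t^e h t^-e is a pinch is decided by membership of this element in
    K: for e = false one needs h in phi(K), that is, psi h in K. *)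
Definition assoc_arg (psi : H -> H) (e : bool) (h : H) : H := if e then h else psi h.

Definition dom (e : bool) : set H := [set h | K (assoc_arg psi e h)].

Lemma twistK e : cancel (twist e) (twist (~~ e)).
Proof. by case: e. Qed.

Lemma dom_twist e k : dom e k -> dom (~~ e) (twist e k).
Proof. by case: e; rewrite /dom /= ?phiK. Qed.

Lemma dom_subgroup e : subgroup (dom e).
Proof.
have [K1 KM KV] := sK; case: e => //; rewrite /dom /=; split=> /=.
- by rewrite gmulf1.
- by move=> x y Kx Ky; rewrite gmulfM; apply: KM.
- by move=> x Kx; rewrite gmulfV; apply: KV.
Qed.

Lemma hnn_stable_twist e k :
  dom e k -> stable e * base k = base (twist e k) * stable e.
Proof.
case: e => [|Kk]; first exact: hnn_stableJ.
have := @hnn_stableJ _ K phi (psi k) Kk; rewrite psiK => E.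
by apply: (canLR (mulKg _)); rewrite mulgA E mulgK.
Qed.

Lemma hnn_stableN e : stable (~~ e) = (stable e)^-1.
Proof. by case: e; rewrite //= invgK. Qed.

Definition syllables (l : seq (bool * H)) : G :=
  foldr (fun eg u => stable eg.1 * base eg.2 * u) 1 l.

Lemma syllables_cons e g l :
  syllables ((e, g) :: l) = stable e * base g * syllables l.
Proof. by []. Qed.

Definition no_pinch (x y : bool * H) : bool :=
  ~~ ((y.1 == ~~ x.1) && `[< dom x.1 x.2 >]).

(** A stable letter put in front of a reduced word either creates no pinch, or
    cancels against the first stable letter of the word; what remains is then a
    suffix of a reduced word, so no further reduction is needed. *)
Lemma hnn_reduced_stable e h l : sorted no_pinch l ->
  exists h' l', sorted no_pinch l' /\
    stable e * (base h * syllables l) = base h' * syllables l'.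
Proof.
case: l => [|[e' g] l] rl.
  by exists 1, [:: (e, h)]; rewrite hnn_base1 mul1g syllables_cons mulgA.
have [np|] := boolP (no_pinch (e, h) (e', g)).
  exists 1, [:: (e, h), (e', g) & l]; split; first by rewrite /= np.
  by rewrite hnn_base1 mul1g [in RHS]syllables_cons !mulgA.
rewrite negbK => /andP[/eqP e'E /asboolP eh].
exists (twist e h * g), l; split; first exact: path_sorted rl.
rewrite mulgA (hnn_stable_twist eh) syllables_cons (e'E : e' = ~~ e) hnn_stableN hnn_baseM.
by rewrite !mulgA mulgK.
Qed.

Lemma hnn_reduced_form (u : G) :
  exists h l, sorted no_pinch l /\ u = base h * syllables l.
Proof.
elim/presented_ind: u => [|x u [h [l [rl ->]]]|x u [h [l [rl ->]]]].
- by exists 1, [::]; rewrite hnn_base1 mulg1.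
- case: x => [k|]; last exact: (hnn_reduced_stable true).
  by exists (k * h), l; split=> //; rewrite hnn_baseM mulgA.
- case: x => [k|]; last exact: (hnn_reduced_stable false).
  by exists (k^-1 * h), l; split=> //; rewrite hnn_baseM hnn_baseV mulgA.
Qed.

(** [Step r1 e1 (Step r2 e2 ... (Last g))] stands for the normal form
    r1 t^e1 r2 t^e2 ... g, where each r is a coset representative. *)
Inductive nform := Last of H | Step of H & bool & nform.

(** In h t^e, an element k of dom (~~ e) at the end of h can be moved across:
    k t^e = t^e (t^-e k t^e). Hence only the coset h dom (~~ e) matters. *)
Definition rep (e : bool) : H -> H := coset_rep (dom (~~ e)).

(** Left multiplication of a normal form by h: the first coset changes, and the
    error term is pushed across the stable letter. *)
Fixpoint nf_base (h : H) (w : nform) : nform :=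
  match w with
  | Last g => Last (h * g)
  | Step r e w' =>
      Step (rep e (h * r)) e
        (nf_base (twist (~~ e) ((rep e (h * r))^-1 * (h * r))) w')
  end.

Definition starts (e : bool) (w : nform) : bool :=
  if w is Step r e' _ then (r == 1) && (e' == e) else false.

Definition unstep (w : nform) : nform := if w is Step _ _ w' then w' else w.

Definition nf_stable (e : bool) (w : nform) : nform :=
  if starts (~~ e) w then unstep w else Step 1 e w.

Fixpoint normal (w : nform) : bool :=
  if w is Step r e w' then [&& rep e r == r, ~~ starts (~~ e) w' & normal w']
  else true.

Lemma rep_mem e h : dom (~~ e) ((rep e h)^-1 * h).
Proof. exact: (coset_rep_mem (dom_subgroup _)). Qed.

Lemma rep1 e k : dom (~~ e) k -> rep e k = 1.
Proof. by move=> ?; apply/(coset_rep_eq1 (dom_subgroup _)). Qed.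

Lemma rep_mul e h k : rep e (h * rep e k) = rep e (h * k).
Proof.
rewrite -[in RHS](mulVKg (rep e k) k) mulgA [RHS]coset_repMr //.
  exact: dom_subgroup.
exact: rep_mem.
Qed.

(** Whether t^e cancels against the head of w depends only on whether the first
    coset is dom e itself, and multiplication by an element of dom e does not
    affect this. *)
Lemma starts_base e h w : normal w -> dom e h ->
  starts (~~ e) (nf_base h w) = starts (~~ e) w.
Proof.
case: w => //= r e' w /and3P[/eqP rr _ _] eh.
have [ee'|_] := eqVneq e' (~~ e); last by rewrite !andbF.
have sd := dom_subgroup e; rewrite !andbT -[in RHS]rr ee' /rep negbK.
apply/eqP/eqP => /(coset_rep_eq1 sd) eg; apply/(coset_rep_eq1 sd).
  by apply/(subgroupMl sd r eh).
by apply/(subgroupMl sd r eh).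
Qed.

Lemma nf_baseM h k w : nf_base (h * k) w = nf_base h (nf_base k w).
Proof.
elim: w h k => [g|r e w IH] h k /=; first by rewrite mulgA.
rewrite rep_mul -IH -gmulfM !mulgA; congr (Step _ _ (nf_base (twist _ _) _)).
by rewrite mulgK.
Qed.

Lemma nf_base1 w : normal w -> nf_base 1 w = w.
Proof.
elim: w => [g|r e w IH] /=; first by rewrite mul1g.
by case/and3P => /eqP rr _ nw; rewrite !mul1g rr mulVg gmulf1 IH.
Qed.

Lemma normal_base h w : normal w -> normal (nf_base h w).
Proof.
elim: w h => [//|r e w IH] h /= /and3P[_ sw nw]; apply/and3P; split.
- by apply/eqP; rewrite /rep coset_rep_id //; apply: dom_subgroup.
- rewrite starts_base // -[X in dom X](negbK e).
  exact/dom_twist/rep_mem.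
- exact: IH.
Qed.

Lemma normal_stable e w : normal w -> normal (nf_stable e w).
Proof.
rewrite /nf_stable; case: ifPn => [|sw nw].
  by case: w => //= r e' w _ /and3P[].
by rewrite /= sw nw rep1 ?eqxx //; case: (dom_subgroup (~~ e)).
Qed.

Lemma nf_stableK e w : normal w -> nf_stable (~~ e) (nf_stable e w) = w.
Proof.
rewrite [nf_stable e w]/nf_stable; case: ifPn => [|sw nw]; last first.
  by rewrite /nf_stable negbK /= !eqxx.
rewrite /nf_stable; case: w => //= r e' w /andP[/eqP-> /eqP->] /and3P[_ sw _].
by rewrite (negPf sw).
Qed.

(** Normality is what makes this hold when no cancellation takes place: then
    none takes place after multiplication by k either. *)
Lemma nf_stable_twist e k w : normal w -> dom e k ->
  nf_stable e (nf_base k w) = nf_base (twist e k) (nf_stable e w).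
Proof.
move=> nw ek; rewrite /nf_stable starts_base //; case: ifPn => [|_].
  case: w {nw} => //= r e' w /andP[/eqP-> /eqP->].
  by rewrite mulg1 rep1 ?negbK // invg1 mul1g.
by rewrite /= mulg1 rep1 ?invg1 ?mul1g ?twistK //; apply: dom_twist.
Qed.

Local Notation NF := {w : nform | normal w}.

Definition NF_base (h : H) (w : NF) : NF :=
  exist _ (nf_base h (val w)) (normal_base h (valP w)).

Definition NF_stable (e : bool) (w : NF) : NF :=
  exist _ (nf_stable e (val w)) (normal_stable e (valP w)).

Lemma NF_baseM h k w : NF_base (h * k) w = NF_base h (NF_base k w).
Proof. by apply: val_inj => /=; apply: nf_baseM. Qed.

Lemma NF_base1 w : NF_base 1 w = w.
Proof. by apply: val_inj => /=; apply/nf_base1/valP. Qed.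

Lemma NF_baseK h : cancel (NF_base h) (NF_base h^-1).
Proof. by move=> w; rewrite -NF_baseM mulVg NF_base1. Qed.

Lemma NF_baseVK h : cancel (NF_base h^-1) (NF_base h).
Proof. by move=> w; rewrite -NF_baseM mulgV NF_base1. Qed.

Lemma NF_stableK e : cancel (NF_stable e) (NF_stable (~~ e)).
Proof. by move=> w; apply: val_inj => /=; apply/nf_stableK/valP. Qed.

Definition base_sym (h : H) : sym NF := Sym (NF_baseK h) (NF_baseVK h).
Definition stable_sym : sym NF := Sym (NF_stableK true) (NF_stableK false).

(** All relators of the HNN extension hold among these permutations, so the
    extension acts on normal forms; this is the source of all nontriviality. *)
Lemma hnn_action : exists F : hom G (sym NF),
  (forall h w, val (F (base h) w) = nf_base h (val w)) /\
  (forall e w, val (F (stable e) w) = nf_stable e (val w)).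
Proof.
have [||F [Fb Fs]] := @hnn_lift _ K phi _ base_sym stable_sym.
- by move=> h k; apply: sym_ext => w; apply: NF_baseM.
- move=> k Kk; apply: sym_ext => w; apply: val_inj.
  exact: (@nf_stable_twist true _ _ (valP w)).
exists F; split=> [h w|e w]; first by rewrite Fb.
case: e; first by rewrite Fs.
by rewrite (hnn_stableN true) gmulfV Fs.
Qed.

(** Apply a reduced word to the normal form 1: absence of pinches means that
    each stable letter is appended rather than cancelled, so the result starts
    with the first stable letter of the word and differs from 1 unless the
    word lies in the base group, which acts on 1 by translation. *)
Theorem britton h l : sorted no_pinch l -> base h * syllables l = 1 ->
  l = [::] /\ h = 1.
Proof.
have [F [Fb Fs]] := hnn_action.
pose w1 : NF := exist _ (Last 1) isT.
have step l' : sorted no_pinch l' -> exists w, val (F (syllables l') w1) =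
    if l' is (e, _) :: _ then Step 1 e w else Last 1.
  elim: l' => [_|[e g] l' IH rl] /=; first by exists (Last 1); rewrite gmulf1.
  have [w wE] := IH (path_sorted rl).
  exists (nf_base g (val (F (syllables l') w1))).
  rewrite !gmulfM [LHS]Fs Fb /nf_stable wE.
  case: l' rl {IH wE} => [//|[e' g'] l' /= /andP[+ _]].
  move=> np; rewrite /= mulg1 andbC ifF //; apply/negbTE; apply: contra np.
  case/andP=> /eqP-> /eqP; rewrite eqxx /rep negbK.
  by move=> /(coset_rep_eq1 (dom_subgroup _)) eg; apply/asboolP.
move=> rl hl1; have [w] := step l rl.
have := congr1 (fun f : sym NF => val (f w1)) (congr1 F hl1).
rewrite gmulfM gmulf1 [LHS]Fb => + wE; rewrite wE.
case: l {rl hl1 wE} => [|[e g] l] //= -[]; rewrite mulg1.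
by split.
Qed.

End Britton.

(** * Separating elements of HNN extensions by enlarging K *)

Section HNNResidual.
Local Open Scope group_scope.
Local Open Scope classical_set_scope.
Variables (H : groupType) (phi psi : hom H H).
Hypotheses (phiK : cancel phi psi) (psiK : cancel psi phi).

Lemma hnn_map (K K' : set H) : K `<=` K' ->
  exists F : hom (HNN K phi) (HNN K' phi),
    (forall v, exists u, F u = v) /\
    (forall h l, F (hnn_base K phi h * syllables K phi l) =
                 hnn_base K' phi h * syllables K' phi l).
Proof.
move=> KK'; have [||F [Fb Ft]] := @hnn_lift _ K phi _ (hnn_base K' phi)
  (hnn_stable K' phi true); first exact: hnn_baseM.
  by move=> k /KK'; apply: hnn_stableJ.
exists F; split=> [v|h l].
  elim/presented_ind: v => [|x v [u <-]|x v [u <-]].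
  - by exists 1; rewrite gmulf1.
  - case: x => [h|].
      by exists (hnn_base K phi h * u); rewrite gmulfM Fb.
    by exists (hnn_stable K phi true * u); rewrite gmulfM Ft.
  - case: x => [h|].
      by exists ((hnn_base K phi h)^-1 * u); rewrite gmulfM gmulfV Fb.
    by exists ((hnn_stable K phi true)^-1 * u); rewrite gmulfM gmulfV Ft.
have Fs e : F (hnn_stable K phi e) = hnn_stable K' phi e.
  by case: e; rewrite // (hnn_stableN _ _ true) gmulfV Ft.
rewrite gmulfM Fb; congr (_ * _).
elim: l => [|[e g] l IH]; first exact: gmulf1.
by rewrite !syllables_cons !gmulfM Fs Fb IH.
Qed.

(** The finite set s consists of those base elements of a reduced word for u
    that must stay outside the associated subgroups for the word to remain
    reduced. *)
Lemma hnn_separation (K : set H) (u : HNN K phi) : subgroup K -> u <> 1 ->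
  exists2 s : seq H, {in s, forall h, ~ K h} &
    forall K', subgroup K' -> K `<=` K' -> {in s, forall h, ~ K' h} ->
      exists2 F : hom (HNN K phi) (HNN K' phi),
        (forall v, exists u', F u' = v) & F u <> 1.
Proof.
move=> sK u1; have [h [l [rl uE]]] := hnn_reduced_form psiK u.
pose s := [seq assoc_arg psi x.1 x.2 | x <- l].
exists [seq g <- s | ~~ `[< K g >]].
  by move=> g; rewrite mem_filter => /andP[/asboolPn].
move=> K' sK' KK' sepK'; have [F [Fsurj FE]] := hnn_map KK'.
exists F => //; rewrite uE FE => /(britton sK' phiK psiK) [|l0 h1].
  apply: (sub_in_sorted _ (allss l)) rl => x y xl _; apply: contra => /andP[-> /asboolP K'x].
  apply/asboolP/notP => Kx; apply: sepK' K'x.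
  rewrite mem_filter; apply/andP; split; first exact/asboolPn.
  exact: (map_f (fun z => assoc_arg psi z.1 z.2)).
by apply: u1; rewrite uE l0 h1 hnn_base1 mulg1.
Qed.

End HNNResidual.

(** * Normal subgroups with finite quotient *)

Section FiniteIndex.
Local Open Scope group_scope.
Local Open Scope classical_set_scope.

Lemma normal_closure_id (G : groupType) (N : set G) :
  normal_subgroup N -> normal_closure N = N.
Proof.
move=> nN; apply/seteqP; split; first exact: normal_closure_min.
exact: mem_normal_closure.
Qed.

Definition finite_quotient (G : groupType) (N : set G) : Prop :=
  normal_subgroup N /\ finite_set [set: quo N].

Lemma finite_set_inj (A B : Type) (f : A -> B) :
  injective f -> finite_set [set: B] -> finite_set [set: A].
Proof.
move=> fI finB; rewrite -(eq_finite_set (inj_card_eq (f := f) (in2W fI))).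
exact: sub_finite_set finB.
Qed.

Lemma finite_quotientT (G : groupType) : finite_quotient [set: G].
Proof.
split; first by [].
apply: (@finite_set_inj _ unit (fun=> tt)); last exact: finite_finset.
move=> x y _.
rewrite -(quo_class_repr x) -(quo_class_repr y).
by apply/quo_classP; apply: mem_normal_closure.
Qed.

Lemma ker_normal (G H : groupType) (f : hom G H) :
  normal_subgroup [set x | f x = 1].
Proof.
split; first split=> /=.
- exact: gmulf1.
- by move=> u v fu fv; rewrite gmulfM fu fv mulg1.
- by move=> u fu; rewrite gmulfV fu invg1.
- by move=> u g /= fu; rewrite gmulfJ fu conj1g.
Qed.

Lemma finite_quotient_ker (G H : groupType) (f : hom G H) :
  finite_set [set: H] -> finite_quotient [set x | f x = 1].
Proof.
move=> finH; split; first exact: ker_normal.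
pose g (x : quo [set x | f x = 1]) := f (repr x).
apply: (@finite_set_inj _ _ g) finH => x y fxy.
rewrite -(quo_class_repr x) -(quo_class_repr y).
apply/quo_classP; rewrite normal_closure_id; last exact: ker_normal.
by rewrite /= gmulfM gmulfV [f _]fxy mulVg.
Qed.

Lemma normal_setI (G : groupType) (M N : set G) :
  normal_subgroup M -> normal_subgroup N -> normal_subgroup (M `&` N).
Proof.
move=> [[M1 MM MV] MJ] [[N1 NM NV] NJ]; split; first split.
- by [].
- by move=> x y [Mx Nx] [My Ny]; split; [apply: MM|apply: NM].
- by move=> x [Mx Nx]; split; [apply: MV|apply: NV].
- by move=> x g [Mx Nx]; split; [apply: MJ|apply: NJ].
Qed.

(** The quotient by the intersection embeds in the product of the quotients. *)
Lemma finite_quotientI (G : groupType) (M N : set G) :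
  finite_quotient M -> finite_quotient N -> finite_quotient (M `&` N).
Proof.
move=> [nM fM] [nN fN]; have nMN := normal_setI nM nN; split=> //.
have := finite_setX fM fN; rewrite setXTT.
pose f (x : quo (M `&` N)) := (quo_class M (repr x), quo_class N (repr x)).
apply: (@finite_set_inj _ _ f) => x y [].
move=> /quo_classP + /quo_classP; rewrite !normal_closure_id // => Mxy Nxy.
rewrite -(quo_class_repr x) -(quo_class_repr y).
by apply/quo_classP; rewrite normal_closure_id.
Qed.

(** N is the kernel of the composite of the free group onto the presented group
    and then onto a finite quotient in which x survives. *)
Lemma residually_finite_separation (X : choiceType) (R : set (free_group X)) x :
  residually_finite (presented R) -> ~ normal_closure R x ->
  exists N, [/\ finite_quotient N, R `<=` N & ~ N x].
Proof.
move=> rfR /(contra_not (quo_class_eq1 R x).1)/rfR [H [f [finH _ fx]]].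
exists [set y | (f \o quo_class R) y = 1]; split=> //.
  exact: finite_quotient_ker.
by move=> r /mem_normal_closure/quo_class_eq1 /= ->; rewrite gmulf1.
Qed.

End FiniteIndex.

(** * The alphabet with two extra letters *)

Section Hat.
Local Open Scope group_scope.
Local Open Scope classical_set_scope.
Variable X : countType.

Definition hat_proj : hom (free_group (hat X)) (free_group X) :=
  free_lift (fun y : hat X => if y is inl x then free_gen x else 1).

(** The relators p and q kill exactly the new letters: the quotient of the
    enlarged free group is still the group presented by R. Deleting
    p and q and including the alphabets again does not change classes modulo
    the new relators, as one sees on generators. *)
Lemma hat_rel_closure (R : set (free_group X)) y :
  normal_closure (hat_rel R) y <-> normal_closure R (hat_proj y).
Proof.
split=> [|Ry].
  apply: (normal_closure_min (N := [set z | normal_closure R (hat_proj z)])).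
    have -> : [set z | normal_closure R (hat_proj z)] =
        [set z | (quo_class R \o hat_proj) z = 1].
      by apply/funext => z; apply/propext; split=> /quo_class_eq1.
    exact: ker_normal.
  move=> z [[r Rr <-]|[]-> /=]; last 2 first.
  - by rewrite free_lift_gen; case: (normal_closureP R) => -[].
  - by rewrite free_lift_gen; case: (normal_closureP R) => -[].
  rewrite /= -[hat_proj _]/((hat_proj \o free_map (inl : X -> hat X)) r).
  rewrite (@free_hom_ext _ _ _ idfun); first exact: mem_normal_closure.
  by move=> x /=; rewrite !free_lift_gen.
apply/quo_class_eq1; pose f := quo_class (hat_rel R) \o free_map (inl : X -> hat X).
rewrite (@free_hom_ext _ _ (quo_class (hat_rel R)) (f \o hat_proj)).
  apply: (normal_closure_ker (f := f)) Ry => r Rr.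
  by apply/quo_class_eq1; apply: mem_normal_closure; left; exists r.
case=> [x|b] /=; rewrite free_lift_gen.
  by rewrite free_lift_gen.
rewrite gmulf1 [RHS]gmulf1; apply/quo_class_eq1; apply: mem_normal_closure; right.
by case: b; [left|right].
Qed.

End Hat.

(** * Separating elements from the subgroups K *)

Section Main.
Local Open Scope group_scope.
Local Open Scope classical_set_scope.
Variables (i : nat) (D : Tdata i) (X : countType).
Local Notation KX R := (KP D (CountablePresentation (R : set (free_group X)))).

Lemma KP_subgroup R : subgroup (KX R).
Proof.
have [[N1 NM NV] _] := normal_closureP (hat_rel R); rewrite /KP /=; split.
- by exists 1; rewrite ?gmulf1.
- by move=> _ _ [x Nx <-] [y Ny <-]; exists (x * y); rewrite ?gmulfM //; apply: NM.
- by move=> _ [x Nx <-]; exists x^-1; rewrite ?gmulfV //; apply: NV.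
Qed.

(** Injectivity of the identification of the free group with M turns membership
    in K_P into the word problem of the presentation. *)
Lemma KP_ident R y : KX R (ident D X y) <-> normal_closure R (hat_proj X y).
Proof.
split=> [[z Rz /ident_inj <-]|Ry]; first exact/hat_rel_closure.
by exists y => //; apply/hat_rel_closure.
Qed.

Lemma KP_le R S : R `<=` normal_closure S -> KX R `<=` KX S.
Proof.
move=> RS _ [y /hat_rel_closure Ry <-]; apply/KP_ident.
exact: normal_closure_min (normal_closureP S) RS _ Ry.
Qed.

(** Elements outside M lie in no K_N, so then any N will do; the others are
    separated by residual finiteness. *)
Lemma KP_separation R h : residually_finite (presented R) -> ~ KX R h ->
  exists N, [/\ finite_quotient N, R `<=` N & ~ KX N h].
Proof.
move=> rfR Rh; have [[y _ yh]|nh] := pselect (range (ident D X) h).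
  move: Rh; rewrite -yh => /(contra_not (KP_ident R y).2).
  case/(residually_finite_separation rfR) => N [fN RN Ny]; exists N; split=> //.
  by move=> /KP_ident; rewrite normal_closure_id //; case: fN.
exists setT; split=> //; first exact: finite_quotientT.
by move=> [y _ yh]; apply: nh; exists y.
Qed.

(** One N for all elements of s, by intersecting: K_N shrinks with N. *)
Lemma KP_separation_seq R (s : seq (tri i)) : residually_finite (presented R) ->
  {in s, forall h, ~ KX R h} ->
  exists N, [/\ finite_quotient N, R `<=` N & {in s, forall h, ~ KX N h}].
Proof.
move=> rfR; elim: s => [_|h s IH sR].
  by exists setT; split=> //; apply: finite_quotientT.
have [|M [fM RM sM]] := IH; first by move=> g gs; apply: sR; rewrite inE gs orbT.
have [|N [fN RN hN]] := KP_separation rfR (h := h); first exact/sR/mem_head.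
exists (M `&` N); split; first exact: finite_quotientI.
  by move=> r Rr; split; [apply: RM|apply: RN].
move=> g; rewrite inE => /predU1P[->|gs].
  by apply: contra_not hN; apply: KP_le => r [_]; apply: mem_normal_closure.
apply: contra_not (sM g gs); apply: KP_le => r [+ _].
exact: mem_normal_closure.
Qed.

End Main.

Theorem theorem3 (i : nat) (hi : 6 <= i) (D : Tdata i)
    (P : countable_presentation) :
  residually_finite (pi1 P) -> residually (T_Fin D) (TP D P).
Proof.
case: P => X R rfR u u1.
(* phi has order 3, so its square is its inverse. *)
have psiK : cancel (@tri_phi i \o @tri_phi i) (@tri_phi i) := @tri_phi3 i.
have phiK : cancel (@tri_phi i) (@tri_phi i \o @tri_phi i) := @tri_phi3 i.
have [s sR sep] := hnn_separation phiK psiK (KP_subgroup D R) u1.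
have [N [fN RN sN]] := KP_separation_seq rfR sR.
have [|F Fsurj Fu] := sep _ (KP_subgroup D N) _ sN.
  by apply: KP_le => r /RN; apply: mem_normal_closure.
exists (TP D (CountablePresentation N)), F; split=> //.
by exists (CountablePresentation N); first by case: fN.
Qed.
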